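(* Let $A = (a_{ij})_{i,j=1}^n$ be a real $n \times n$ matrix. If $-A$ is relatively $D$-stable for some $\theta$ with $0 \leq \theta < \frac{\pi}{2}$, and, in addition, $a_{ii} > 0$ for each $i = 1, \ldots, n$, then $$\det A \leq \frac{1}{\cos^n \theta}\prod_{i=1}^n a_{ii}.$$
   Context: For $0 < \theta < \frac{\pi}{2}$ let $\mathbb{C}^0_{\theta} = \{z = x+iy \in \mathbb{C} : x < 0,\ x\tan\theta < y < -x\tan\theta\}$ be the open conic sector around the negative real half-axis with apex $0$ and inner angle $2\theta$; for $\theta = 0$, $\mathbb{C}^0_0$ denotes the negative real half-axis $\mathbb{R}^- = (-\infty,0)$. $\sigma(M)$ denotes the set of (complex) eigenvalues of a matrix $M$. A positive diagonal matrix is a diagonal matrix with all diagonal entries positive. For a given $\theta$, a real $n\times n$ matrix $M$ is called relatively $D$-stable (for this $\theta$) if $\sigma(DM) \subset \mathbb{C}^0_\theta$ for every positive diagonal matrix $D$. *)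

(* Defs.v *)
From mathcomp Require Import all_boot all_order all_algebra.
From mathcomp Require Import complex.
From mathcomp Require Import all_classical all_reals all_analysis.

Set Implicit Arguments.
Unset Strict Implicit.
Unset Printing Implicit Defensive.

Import Order.TTheory GRing.Theory Num.Theory.

Local Open Scope classical_set_scope.
Local Open Scope ring_scope.
Local Open Scope complex_scope.

(* The inequalities alone would give the empty set at theta = 0, where the
   sector is instead the open negative half-axis. *)
Definition sector (R : realType) (theta : R) : set R[i] :=
  if theta == 0 then [set z : R[i] | complex.Re z < 0 /\ complex.Im z = 0]
  else [set z : R[i] | complex.Re z < 0 /\
          complex.Re z * tan theta < complex.Im z < - complex.Re z * tan theta].

(* [eigenvalue] uses row eigenvectors, which gives the usual spectrum. *)
Definition spectrum (R : realType) (n : nat) (M : 'M[R]_n) : set R[i] :=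
  [set z : R[i] | eigenvalue (map_mx (real_complex R) M) z].

Definition positive_diagonal (R : realType) (n : nat) (D : 'M[R]_n) : Prop :=
  is_diag_mx D /\ forall i, 0 < D i i.

Definition relatively_Dstable (R : realType) (n : nat) (theta : R)
    (M : 'M[R]_n) : Prop :=
  forall D : 'M[R]_n, positive_diagonal D ->
    spectrum (D *m M) `<=` sector theta.

(* Main.v *)
(** With D = diag(1/a_11, ..., 1/a_nn) the matrix D A has trace n and
    determinant det A / (a_11 ... a_nn).  Every eigenvalue z of - D A lies in
    the sector, that is, |z| cos theta <= - Re z.  So cos^n theta |det (D A)|
    is at most the product of the real parts of the eigenvalues of D A, which
    by AM-GM is at most (tr (D A) / n)^n = 1. *)
Require Import Defs.
From mathcomp Require Import all_boot all_order all_algebra.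
From mathcomp Require Import complex.
From mathcomp Require Import all_classical all_reals all_analysis.

Import Order.TTheory GRing.Theory Num.Theory.
Local Open Scope ring_scope.

(** The characteristic polynomial splits, and [e] lists its roots with multiplicity; trace and
    determinant are read off its coefficients by Vieta. *)
Lemma closed_field_spectrum (F : closedFieldType) (n : nat) (M : 'M[F]_n) :
  exists e : 'I_n -> F, [/\ forall i, eigenvalue M (e i),
    \tr M = \sum_i e i & \det M = \prod_i e i].
Proof.
have [s] := closed_field_poly_normal (char_poly M).
rewrite (monicP (char_poly_monic M)) scale1r => Ms.
have szs : size s = n.
  by apply/succn_inj; rewrite -(size_prod_XsubC s id) -Ms size_char_poly.
exists (fun i => s`_i); split.
- move=> i; rewrite eigenvalue_root_char Ms root_prod_XsubC mem_nth //.
  by rewrite szs ltn_ord.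
(* The coefficient of degree [n.-1] carries the trace only when [n] is positive. *)
- case: n M Ms szs => [|n] M Ms szs; first by rewrite /mxtrace !big_ord0.
  apply: oppr_inj; rewrite -char_poly_trace // Ms -{1}szs.
  by rewrite coefPn_prod_XsubC ?szs // (big_nth 0) szs big_mkord.
- apply: (@mulrI _ ((-1) ^+ n)); first by rewrite unitrX ?unitrN1.
  by rewrite -char_poly_det Ms coef0_prod_XsubC (big_nth 0) szs big_mkord.
Qed.

Lemma det_le_trace_of_spectrum (R : realType) (n : nat) (c : R) (M : 'M[R]_n) :
    0 <= c ->
    (forall z, spectrum M z -> c%:C%C * `|z| <= (- complex.Re z)%:C%C) ->
  c ^+ n * `|\det M| <= (- \tr M / n%:R) ^+ n.
Proof.
move=> c_ge0 specM.
have [e [eM trM detM]] :=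
  closed_field_spectrum _ _ (map_mx (real_complex R) M).
have {}specM i : c%:C%C * `|e i| <= (- complex.Re (e i))%:C%C.
  exact/specM/eM.
(* [M] is real, so taking real parts of the eigenvalue sum leaves the trace unchanged. *)
have trE : - \tr M = \sum_i - complex.Re (e i).
  by rewrite sumrN -(raddf_sum (@complex.Re R)) -trM trace_map_mx.
(* The sign needed for AM-GM comes from the spectral bound, whose left side is nonnegative. *)
have Re_ge0 i : 0 <= - complex.Re (e i).
  by rewrite -lecR (le_trans _ (specM i)) // mulr_ge0 // lecR.
have := @leif_AGM R _ 'I_n (fun i => - complex.Re (e i)) (fun i _ => Re_ge0 i).
rewrite card_ord -trE => -[agm _]; apply: le_trans agm.
rewrite -lecR rmorphM rmorphXn /= rmorph_prod.
have -> : (`|\det M|)%:C%C = `|\prod_i e i|.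
  by rewrite -detM det_map_mx normc_def /= expr0n addr0 sqrtr_sqr.
(* Spreading [c ^+ n] as one [c] per eigenvalue allows a factorwise comparison. *)
rewrite normr_prod -[n in _ ^+ n]card_ord -prodr_const -big_split /=.
by apply: ler_prod => i _; rewrite specM mulr_ge0 // lecR.
Qed.

Lemma cos_gt0_acute (R : realType) (theta : R) :
  0 <= theta -> theta < pi / 2 -> 0 < cos theta.
Proof.
move=> theta_ge0 theta_lt; apply: cos_gt0_pihalf; rewrite theta_lt andbT.
by rewrite (lt_le_trans _ theta_ge0) // oppr_lt0 divr_gt0 ?pi_gt0.
Qed.

Lemma sector_cos_norm (R : realType) (theta : R) (z : R[i]) :
    0 <= theta -> theta < pi / 2 -> sector theta z ->
  (cos theta)%:C%C * `|z| <= (- complex.Re z)%:C%C.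
Proof.
move=> theta_ge0 theta_lt; case: z => x y.
have cos_gt0 : 0 < cos theta by exact: cos_gt0_acute.
(* Clearing the denominator of [tan] gives one inequality that covers both the ray and the open
   sector. *)
have xy : sector theta (x +i* y)%C ->
    x < 0 /\ `|y| * cos theta <= - x * sin theta.
  rewrite /sector; case: eqVneq => [->|_] /= [x_lt0].
    by move=> ->; rewrite normr0 mul0r sin0 mulr0.
  move=> /andP[xy yx]; split => //.
  rewrite -ler_pdivlMr // -mulrA ler_norml -mulNr opprK.
  by rewrite (ltW xy) (ltW yx).
case/xy => x_lt0 {}xy.
rewrite normc_def /= -rmorphM lecR /=.
rewrite -(@ler_pXn2r _ 2) ?nnegrE ?mulr_ge0 ?sqrtr_ge0 ?oppr_ge0
  ?(ltW cos_gt0) ?(ltW x_lt0) //.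
rewrite exprMn sqr_sqrtr ?addr_ge0 ?sqr_ge0 // sqrrN.
(* With sin^2 = 1 - cos^2, this rearranges to cos^2 (x^2 + y^2) <= x^2. *)
have : (`|y| * cos theta) ^+ 2 <= (- x * sin theta) ^+ 2.
  rewrite ler_pXn2r ?nnegrE ?(mulr_ge0 _ (ltW cos_gt0)) //.
  by rewrite (le_trans _ xy) // mulr_ge0 // ltW.
rewrite exprMn real_normK ?num_real // exprMn sqrrN sin2cos2.
by rewrite mulrBr mulr1 lerBrDr -mulrDl [y ^+ 2 + _]addrC
  [_ * cos _ ^+ 2]mulrC.
Qed.

Theorem theorem2 (R : realType) (n : nat) (A : 'M[R]_n) (theta : R)
    (theta_ge0 : 0 <= theta) (theta_lt : theta < pi / 2)
    (stabA : relatively_Dstable theta (- A))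
    (diagA : forall i : 'I_n, 0 < A i i) :
  \det A <= 1 / cos theta ^+ n * \prod_(i < n) A i i.
Proof.
have cos_gt0 : 0 < cos theta by exact: cos_gt0_acute.
pose d := \row_i (A i i)^-1.
have posd : positive_diagonal (diag_mx d).
  split=> [|i]; first exact: diag_mx_is_diag.
  by rewrite !mxE eqxx invr_gt0.
have := @det_le_trace_of_spectrum R n _ (diag_mx d *m - A) (ltW cos_gt0).
have -> : - \tr (diag_mx d *m - A) = n%:R.
  rewrite mulmxN linearN opprK /= /mxtrace.
  under eq_bigr do rewrite mul_diag_mx !mxE mulVf ?gt_eqF //.
  by rewrite sumr_const card_ord.
(* The sign (-1)^n of the determinant disappears under the absolute value. *)
rewrite mulmxN -scaleN1r detZ normrM normrX normrN1 expr1n !mul1r det_mulmx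
  det_diag.
have -> : \prod_i d 0 i = (\prod_i A i i)^-1.
  by rewrite -prodfV; apply: eq_bigr => i _; rewrite mxE.
have prod_gt0 : 0 < \prod_i A i i by exact: prodr_gt0.
rewrite normrM gtr0_norm ?invr_gt0 // => bound.
have {}bound : cos theta ^+ n * ((\prod_i A i i)^-1 * `|\det A|) <= 1.
  apply: le_trans (bound _) _.
    move=> z zspec; apply: sector_cos_norm => //.
    by apply: stabA posd _ _; rewrite mulmxN -scaleN1r.
  (* For [n = 0] the quotient 0 / 0 is 0, but its power with exponent 0 is still 1. *)
  case: (n) => [|m]; first by rewrite expr0.
  by rewrite divff ?expr1n // pnatr_eq0.
apply: le_trans (ler_norm _) _.
by rewrite mulrC ler_pdivlMr ?exprn_gt0 //
  -[leRHS]mulr1 -ler_pdivrMl // mulrA mulrC.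
Qed.
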